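(* Let $f$ and $g$ be analytic in the strip $-1\le \operatorname{Im} z\le 1$ and $$\lim_{x\to\pm\infty}\int_{-1/2}^{1/2}|f(x+iy+iu)|^2\,dy=\lim_{x\to\pm\infty}\int_{-1/2}^{1/2}|g(x+iy+iu)|^2\,dy=0,$$ uniformly for $|u|\le 1/2$. Moreover, assume that $f$ and $g$ are real-valued on $\mathbb R$. Then $$(Tf,g)=-(f,Tg),$$ that is, $T^*=-T$.
   Context: The central difference operator $T$ is $(Tf)(x)=\dfrac{f(x+i/2)-f(x-i/2)}{i}$. The real inner product is $(f,g)=\int_{\mathbb R}f(x)g(x)\,dx$, considered for real-valued functions with the corresponding space $L_2(\mathbb R,dx)$, on which $T$ is densely defined; $T^*$ denotes the adjoint of $T$ with respect to this inner product. *)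

(* Defs.v *)
From HB Require Import structures.
From mathcomp Require Import all_boot all_order all_algebra.
From mathcomp Require Import complex.
From mathcomp Require Import all_classical all_reals all_analysis.
Set Implicit Arguments.
Unset Strict Implicit.
Unset Printing Implicit Defensive.
Import Order.TTheory GRing.Theory Num.Theory.
Import numFieldNormedType.Exports.
Local Open Scope classical_set_scope.
Local Open Scope ring_scope.
Local Open Scope complex_scope.

Section difference_operator.
Context {R : realType}.
Local Notation C := R[i].
Local Notation mu := (@lebesgue_measure R).

Definition strip : set C := [set z | -1 <= complex.Im z <= 1].

(* Analytic at every point of A, i.e. complex differentiable in a
   neighborhood of it. The copy R[i]^o is the one on which the topology is
   defined, and R[i] is taken over itself, so that derivable in the direction
   1 is complex differentiability. *)
Definition analytic_on (A : set C) (f : C -> C) : Prop :=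
  forall z : C^o, A z -> \forall w \near z, derivable (f : C^o -> C^o) w 1.

Definition real_on_line (f : C -> C) : Prop :=
  forall x : R, complex.Im (f x%:C) = 0.

(* \int_{-1/2}^{1/2} |f(x + iy + iu)|^2 dy *)
Definition slice_energy (f : C -> C) (x u : R) : R :=
  \int[mu]_(y in `[- 2^-1, 2^-1]) ComplexField.Normc.normc (f (x +i* (y + u))) ^+ 2.

Definition slice_decay (f : C -> C) : Prop :=
  {uniform `[(- 2^-1 : R), 2^-1], slice_energy f @ +oo --> (fun=> 0 : R)} /\
  {uniform `[(- 2^-1 : R), 2^-1], slice_energy f @ -oo --> (fun=> 0 : R)}.

Definition admissible (f : C -> C) : Prop :=
  [/\ analytic_on strip f, slice_decay f & real_on_line f].

Definition central_diff (f : C -> C) : C -> C :=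
  fun z => (f (z + 'i%C / 2) - f (z - 'i%C / 2)) / 'i%C.

Definition on_line (f : C -> C) : R -> C := fun x => f x%:C.

Definition cintegrable (F : R -> C) : Prop :=
  mu.-integrable setT (fun x => (complex.Re (F x))%:E) /\
  mu.-integrable setT (fun x => (complex.Im (F x))%:E).

(* \int_R F G, without conjugation: it is the real inner product when F and G
   are real-valued. *)
Definition inner (F G : R -> C) : C :=
  (\int[mu]_x complex.Re (F x * G x)) +i* (\int[mu]_x complex.Im (F x * G x)).

(* The elements of the real space L_2(R, dx), as functions into R[i]. *)
Definition real_L2 (F : R -> C) : Prop :=
  exists2 u : R -> R, u \in Lfun mu 2%:E & forall x, F x = (u x)%:C.

(* The domain of T = central_diff as an operator in the real space L_2(R, dx), an element of
   which is represented by its analytic extension to the strip. *)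
Definition dom_T : set (C -> C) :=
  [set f | [/\ admissible f, real_L2 (on_line f)
             & real_L2 (on_line (central_diff f))]].

(* The graph of T^*: G is in the domain of T^* and T^* G = H. *)
Definition adjoint_T (G H : R -> C) : Prop :=
  [/\ real_L2 G, real_L2 H
    & forall f, dom_T f ->
        inner (on_line (central_diff f)) G = inner (on_line f) H].

End difference_operator.

(* Main.v *)
Require Import Defs.
From HB Require Import structures.
From mathcomp Require Import all_boot all_order all_algebra.
From mathcomp Require Import complex.
From mathcomp Require Import all_classical all_reals all_analysis.
From mathcomp Require Import measurable_realfun.
From mathcomp Require Import ring lra.
Import Order.TTheory GRing.Theory Num.Theory.
Import numFieldNormedType.Exports.
Local Open Scope classical_set_scope.
Local Open Scope ring_scope.
Local Open Scope complex_scope.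
Set Implicit Arguments.
Unset Strict Implicit.
Unset Printing Implicit Defensive.

(** The jump of k(z) = f(z) g(z - i/2) + f(z - i/2) g(z) over height
    1/2 is k(x + i/2) - k(x) = i ((Tf) g + f (Tg))(x).  As k is holomorphic for
    0 <= Im z <= 1/2, Cauchy's theorem on the rectangle [-N, N] x [0, 1/2] turns
    the integral of the jump into the integrals of k over the two vertical
    sides, which tend to 0 with the slice energies of f and g.  Only pointwise
    complex differentiability is available, so Cauchy's theorem is obtained by
    Goursat's bisection, for closed real 1-forms P dx + Q dy.

    For the adjoint it remains to see that the domain of T is dense.  It contains
    w (1 - (1 - s^n)^(2^n)), where w(z) = 1 / (4 + z^2) and s is a multiple of
    1 / (4 + (z - c)^2) with s > 1/2 exactly on the real interval |x - c| < r.
    These functions converge on the real line to w times the indicator of that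
    interval, so a v in L_2 orthogonal to the domain satisfies
    \int_(|x - c| < r) w v = 0 for all c and all small r, and v = 0 almost
    everywhere by Lebesgue differentiation. *)

(** * Integrals of continuous functions over real segments *)

Section segment_integral.
Context {R : realType}.
Implicit Types (f : R -> R) (a w : R).
Local Notation mu := (@lebesgue_measure R).

(** The width replaces the right end, since bisection halves widths. *)
Definition seg_int f a w : R := \int[mu]_(x in `[a, a + w]) f x.

Definition cont_on f (a b : R) := forall x, a <= x <= b -> {for x, continuous f}.

Lemma cont_on_integrable f a b : cont_on f a b ->
  mu.-integrable `[a, b] (EFin \o f).
Proof.
move=> cf; apply: continuous_compact_integrable; first exact: segment_compact.
apply: continuous_in_subspaceT => x; rewrite inE/= in_itv/=; exact: cf.
Qed.

Lemma seg_int_split f a w w' : 0 <= w -> 0 <= w' -> cont_on f a (a + w + w') ->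
  seg_int f a (w + w') = seg_int f a w + seg_int f (a + w) w'.
Proof.
move=> w0 w'0 cf; rewrite /seg_int.
have itf := cont_on_integrable cf; rewrite !addrA.
rewrite -(@Rintegral_itv_obnd_cbnd _ (a + w)); last first.
  apply: integrableS itf => //.
  by move=> x /=; rewrite !in_itv/= => /andP[h ->]; rewrite andbT; lra.
rewrite -(@Rintegral_itvB _ f (BLeft a) (BRight (a + w + w')) (a + w)) ?bnd_simp ?lerDl//.
by rewrite [RHS]addrC subrK.
Qed.

(** The number [k * w] is the integral of the constant [k]. Goursat's argument applies this to the
    difference of [P] or [Q] on opposite sides of a small rectangle, which is nearly constant. *)
Lemma seg_int_approx f a w k e : 0 <= w -> cont_on f a (a + w) ->
  (forall x, a <= x <= a + w -> `|f x - k| <= e) ->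
  `|seg_int f a w - k * w| <= e * w.
Proof.
move=> w0 cf fk; rewrite /seg_int.
have itf := cont_on_integrable cf.
have itc c : mu.-integrable `[a, a + w] (EFin \o cst c).
  by apply: cont_on_integrable => x _; exact: cvg_cst.
have ec c : c * w = \int[mu]_(x in `[a, a + w]) c.
  rewrite Rintegral_cst//= lebesgue_measure_itv/= lte_fin ltrDl.
  case: ltrP => [_|w0']; first by rewrite -EFinB/= addrC addKr.
  by rewrite (@le_anti _ _ w 0) ?w0 ?w0'.
rewrite !ec -RintegralB//; last exact: (itc k).
apply: le_trans.
  apply: le_normr_Rintegral => //.
  exact: (integrableB _ itf (itc k)).
apply: le_Rintegral => //.
- exact: (integrable_norm (integrableB _ itf (itc k))).
- exact: (itc e).
Qed.

Lemma seg_intB f g a w : cont_on f a (a + w) -> cont_on g a (a + w) ->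
  seg_int f a w - seg_int g a w = seg_int (f \- g) a w.
Proof. by move=> cf cg; rewrite /seg_int -RintegralB//; exact: cont_on_integrable. Qed.

End segment_integral.

(** * Goursat's theorem for closed 1-forms *)

Section goursat.
Context {R : realType}.
Implicit Types (P Q : R -> R -> R) (a b w h x y : R).

(* Both components are Fréchet differentiable at (x, y), with dP/dy = dQ/dx
   (the common value is c): the 1-form P dx + Q dy is closed at (x, y). *)
Definition closed_at P Q x y := exists p c q : R, forall e, 0 < e ->
  exists2 d, 0 < d & forall s t, `|s| < d -> `|t| < d ->
   `|P (x + s) (y + t) - P x y - p * s - c * t| <= e * (`|s| + `|t|) /\
   `|Q (x + s) (y + t) - Q x y - c * s - q * t| <= e * (`|s| + `|t|).

Definition closed_on P Q a b w h :=
  forall x y, a <= x <= a + w -> b <= y <= b + h -> closed_at P Q x y.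

(** The counterclockwise circulation of P dx + Q dy. Opposite sides are paired because only their
    differences are estimated. *)
Definition rect_int P Q a b w h : R :=
  seg_int (P^~ b) a w - seg_int (P^~ (b + h)) a w +
  (seg_int (Q (a + w)) b h - seg_int (Q a) b h).

Lemma lipschitz_at_continuous (f : R -> R) x (C d : R) : 0 < d ->
  (forall s, `|s| < d -> `|f (x + s) - f x| <= C * `|s|) ->
  {for x, continuous f}.
Proof.
move=> d0 H; apply/cvgrPdist_le => e e0.
near=> y.
have -> : y = x + (y - x) by rewrite addrC subrK.
rewrite distrC; apply: le_trans (H _ _) _.
  by rewrite distrC; near: y; apply: cvgr_dist_lt => //; exact: cvg_id.
apply: (@le_trans _ _ ((`|C| + 1) * `|y - x|)).
  by rewrite ler_wpM2r// (le_trans (ler_norm _))// lerDl.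
have C1 : 0 < `|C| + 1 by rewrite ltr_wpDl.
rewrite mulrC -ler_pdivlMr// distrC; apply: ltW.
by near: y; apply: cvgr_dist_lt; [exact: cvg_id|rewrite divr_gt0].
Unshelve. all: by end_near. Qed.

(** With e = 1 and no vertical increment, the expansion gives a Lipschitz bound at x with constant
    [|p| + 1]. *)
Lemma closed_at_continuousP1 P Q x y : closed_at P Q x y ->
  {for x, continuous (P^~ y)}.
Proof.
move=> [p [c [q H]]]; have [d d0 K] := H 1 ltr01.
apply: (@lipschitz_at_continuous _ _ (`|p| + 1) d d0) => s sd.
have z0 : `|0 : R| < d by rewrite normr0.
have [+ _] := K s 0 sd z0; rewrite normr0
  addr0 mulr0 subr0 addr0 mul1r => K1.
rewrite -(subrK (p * s) (_ - _)) (le_trans (ler_normD _ _))//.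
by rewrite normrM mulrDl mul1r addrC lerD2l.
Qed.

Lemma closed_at_continuousQ2 P Q x y : closed_at P Q x y ->
  {for y, continuous (Q x)}.
Proof.
move=> [p [c [q H]]]; have [d d0 K] := H 1 ltr01.
apply: (@lipschitz_at_continuous _ _ (`|q| + 1) d d0) => s sd.
have z0 : `|0 : R| < d by rewrite normr0.
have [_] := K 0 s z0 sd; rewrite normr0
  addr0 mulr0 subr0 add0r mul1r => K1.
rewrite -(subrK (q * s) (_ - _)) (le_trans (ler_normD _ _))//.
by rewrite normrM mulrDl mul1r addrC lerD2l.
Qed.

Lemma closed_onP1 P Q a b w h y : closed_on P Q a b w h -> b <= y <= b + h ->
  cont_on (P^~ y) a (a + w).
Proof. by move=> cl yb x xa; apply: closed_at_continuousP1 (cl x y xa yb). Qed.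

Lemma closed_onQ2 P Q a b w h x : closed_on P Q a b w h -> a <= x <= a + w ->
  cont_on (Q x) b (b + h).
Proof. by move=> cl xa y yb; apply: closed_at_continuousQ2 (cl x y xa yb). Qed.

(** Each inner edge is traversed twice, in opposite directions, and cancels. *)
Lemma rect_int_split P Q a b w h : 0 <= w -> 0 <= h ->
  closed_on P Q a b (w + w) (h + h) ->
  rect_int P Q a b (w + w) (h + h) =
  rect_int P Q a b w h + rect_int P Q (a + w) b w h +
  (rect_int P Q a (b + h) w h + rect_int P Q (a + w) (b + h) w h).
Proof.
move=> w0 h0 cl; rewrite /rect_int.
rewrite !(@seg_int_split _ (P^~ _))//; last 2 first.
- by rewrite -addrA; apply: (closed_onP1 cl); lra.
- by rewrite -addrA; apply: (closed_onP1 cl); lra.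
rewrite !(@seg_int_split _ (Q _))//; last 2 first.
- by rewrite -addrA; apply: (closed_onQ2 cl); lra.
- by rewrite -addrA; apply: (closed_onQ2 cl); lra.
rewrite !addrA; ring.
Qed.

(** The affine part contributes [- c * h * w] on the horizontal sides and [c * w * h] on the
    vertical ones; these cancel because the form is closed. The remainder is at most [e * (w + h)]
    at each boundary point, hence at most twice that in a difference of opposite sides. *)
Lemma rect_int_local P Q a b w h x y e d : 0 < e -> 0 <= w -> 0 <= h -> w + h < d ->
  a <= x <= a + w -> b <= y <= b + h -> closed_on P Q a b w h ->
  (exists p c q : R, forall s t, `|s| < d -> `|t| < d ->
   `|P (x + s) (y + t) - P x y - p * s - c * t| <= e * (`|s| + `|t|) /\
   `|Q (x + s) (y + t) - Q x y - c * s - q * t| <= e * (`|s| + `|t|)) ->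
  `|rect_int P Q a b w h| <= 2 * e * (w + h) ^+ 2.
Proof.
move=> e0 w0 h0 whd xa yb cl [p [c [q H]]].
have K u v : a <= u <= a + w -> b <= v <= b + h ->
    `|P u v - P x y - p * (u - x) - c * (v - y)| <= e * (w + h) /\
    `|Q u v - Q x y - c * (u - x) - q * (v - y)| <= e * (w + h).
  move=> ua vb; have ux : `|u - x| <= w by rewrite ler_norml; lra.
  have vy : `|v - y| <= h by rewrite ler_norml; lra.
  have [] := H (u - x) (v - y).
  - by apply: (le_lt_trans ux); lra.
  - by apply: (le_lt_trans vy); lra.
  rewrite ![_ + (_ - _)]addrC !subrK => h1 h2.
  have wh : e * (`|u - x| + `|v - y|) <= e * (w + h) by rewrite ler_wpM2l ?lerD// ltW.
  by split; [apply: le_trans h1 _|apply: le_trans h2 _].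
have bb : b <= b <= b + h by lra.
have bh : b <= b + h <= b + h by lra.
have aa : a <= a <= a + w by lra.
have aw : a <= a + w <= a + w by lra.
rewrite /rect_int (seg_intB (closed_onP1 cl bb) (closed_onP1 cl bh)).
rewrite (seg_intB (closed_onQ2 cl aw) (closed_onQ2 cl aa)).
have A1 : `|seg_int (P^~ b \- P^~ (b + h)) a w - (- c * h) * w| <= 2 * e * (w + h) * w.
  apply: seg_int_approx => //.
    by move=> u ua; apply: cvgB; [exact: (closed_onP1 cl bb)|exact: (closed_onP1 cl bh)].
  move=> u ua /=; have [h1 _] := K u b ua bb; have [h2 _] := K u (b + h) ua bh.
  by move: h1 h2; rewrite !ler_norml; lra.
have A2 : `|seg_int (Q (a + w) \- Q a) b h - (c * w) * h| <= 2 * e * (w + h) * h.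
  apply: seg_int_approx => //.
    by move=> u ua; apply: cvgB; [exact: (closed_onQ2 cl aw)|exact: (closed_onQ2 cl aa)].
  move=> v vb /=; have [_ h1] := K (a + w) v aw vb; have [_ h2] := K a v aa vb.
  by move: h1 h2; rewrite !ler_norml; lra.
by move: A1 A2; rewrite !ler_norml expr2; lra.
Qed.

(** Every left end lies below every right end, so the supremum of the left ends belongs to all
    segments. *)
Lemma nested_segments (u l : nat -> R) : (forall n, 0 <= l n) ->
  (forall n, u n <= u n.+1) -> (forall n, u n.+1 + l n.+1 <= u n + l n) ->
  exists x, forall n, u n <= x <= u n + l n.
Proof.
move=> l0 u1 u2.
have um n m : u n <= u (n + m)%N.
  by elim: m => [|m IH]; rewrite ?addn0// addnS (le_trans IH).
have ul n m : u (n + m)%N + l (n + m)%N <= u n + l n.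
  by elim: m => [|m IH]; rewrite ?addn0// addnS (le_trans _ IH).
have ub n m : u m <= u n + l n.
  rewrite (le_trans (um m n))// addnC (le_trans _ (ul n m))// lerDl//.
have hs : has_ubound (range u) by exists (u 0%N + l 0%N) => _ [m _ <-]; exact: ub.
exists (sup (range u)) => n; apply/andP; split.
  by apply: ub_le_sup; [exact: hs|exists n].
apply: ge_sup; first by exists (u 0%N), 0%N.
by move=> _ [m _ <-]; exact: ub.
Qed.

Lemma le0_scaled_eps (r C : R) : 0 <= C -> (forall e, 0 < e -> r <= e * C) -> r <= 0.
Proof.
move=> C0 H; rewrite leNgt; apply/negP => r0.
have C1 : 0 < C + 1 by rewrite ltr_wpDl.
(* Dividing by [C + 1] rather than [C] allows for [C = 0]. *)
have := H (r / (C + 1)); rewrite divr_gt0// => /(_ isT).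
rewrite mulrAC ler_pdivlMr//; nra.
Qed.

(** If the integral exceeded [e * (w + h) ^+ 2] in absolute value, some quarter would exceed the
    same bound for its own sides, because that bound is also divided by four. Iterating gives nested
    rectangles around a point, and near that point [rect_int_local] rules the excess out. *)
Lemma goursat P Q a b w h : 0 <= w -> 0 <= h ->
  closed_on P Q a b w h -> rect_int P Q a b w h = 0.
Proof.
move=> w0 h0 cl.
apply/eqP; rewrite -normr_le0; apply: (@le0_scaled_eps _ ((w + h) ^+ 2)); first exact: sqr_ge0.
move=> e e0; rewrite leNgt; apply/negP => bad0.
pose W n : R := w / 2 ^+ n; pose H n : R := h / 2 ^+ n.
have WS n : W n = W n.+1 + W n.+1.
  by rewrite /W exprS invfM; field; rewrite expf_neq0//.
have HS n : H n = H n.+1 + H n.+1.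
  by rewrite /H exprS invfM; field; rewrite expf_neq0//.
have W0 n : 0 <= W n by rewrite divr_ge0// exprn_ge0.
have H0 n : 0 <= H n by rewrite divr_ge0// exprn_ge0.
(* Lower left corners of the level-n rectangles that lie in the original one and keep the excess. *)
pose ok n (z : R * R) := [/\ a <= z.1, z.1 + W n <= a + w, b <= z.2, z.2 + H n <= b + h
  & e * (W n + H n) ^+ 2 < `|rect_int P Q z.1 z.2 (W n) (H n)|].
pose sub n (z z' : R * R) := [/\ z.1 <= z'.1, z'.1 + W n.+1 <= z.1 + W n,
  z.2 <= z'.2 & z'.2 + H n.+1 <= z.2 + H n].
(* The premise [ok n z] stands under the existential, so that a successor can be chosen for every
   z. *)
have step n z : exists z', ok n z -> ok n.+1 z' /\ sub n z z'.
  have [okz|] := pselect (ok n z); last by exists z.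
  suff [z' [s1 s2]] : exists z', sub n z z' /\ e * (W n.+1 + H n.+1) ^+ 2 <
      `|rect_int P Q z'.1 z'.2 (W n.+1) (H n.+1)|.
    exists z' => _; split=> //; case: okz s1 => ? ? ? ? _ [? ? ? ?].
    by split=> //; lra.
  have [z1 z2 z3 z4] := okz; move=> bad.
  (* Otherwise all four quarters obey their bounds, which add up to [e * (W n + H n) ^+ 2]. *)
  apply: contrapT => /forallNP N.
  have {}N z' : sub n z z' -> `|rect_int P Q z'.1 z'.2 (W n.+1) (H n.+1)| <=
      e * (W n.+1 + H n.+1) ^+ 2.
    by move=> s; rewrite leNgt; apply/negP => g; apply: (N z').
  have := W0 n.+1; have := H0 n.+1 => Hn Wn.
  have sW := WS n; have sH := HS n.
  have N1 := N (z.1, z.2); have N2 := N (z.1 + W n.+1, z.2).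
  have N3 := N (z.1, z.2 + H n.+1); have N4 := N (z.1 + W n.+1, z.2 + H n.+1).
  move: bad; rewrite sW sH rect_int_split//; last first.
    by rewrite -sW -sH => x y xx yy; apply: cl; lra.
  apply/negP; rewrite -leNgt.
  have {}N1 := N1 ltac:(split => /=; lra).
  have {}N2 := N2 ltac:(split => /=; lra).
  have {}N3 := N3 ltac:(split => /=; lra).
  have {}N4 := N4 ltac:(split => /=; lra).
  move: N1 N2 N3 N4 => /=; set J1 := rect_int _ _ _ _ _ _.
  set J2 := rect_int _ _ _ _ _ _; set J3 := rect_int _ _ _ _ _ _.
  set J4 := rect_int _ _ _ _ _ _; rewrite !ler_norml !expr2; lra.
pose next n z := xget z [set z' | ok n z -> ok n.+1 z' /\ sub n z z'].
have nextP n z : ok n z -> ok n.+1 (next n z) /\ sub n z (next n z).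
  by rewrite /next; case: xgetP => [z' _ //|]; have [z' zz'] := step n z => /(_ z').
pose Z := fix Z n := if n is m.+1 then next m (Z m) else (a, b).
have okZ n : ok n (Z n).
  elim: n => [|n IH] /=; last by have [] := nextP _ _ IH.
  by rewrite /ok /W /H /= expr0 !divr1; split.
have subZ n : sub n (Z n) (Z n.+1) by have [] := nextP _ _ (okZ n).
have [x xP] : exists x, forall n, (Z n).1 <= x <= (Z n).1 + W n.
  by apply: nested_segments => // n; have [] := subZ n.
have [y yP] : exists y, forall n, (Z n).2 <= y <= (Z n).2 + H n.
  by apply: nested_segments => // n; have [] := subZ n.
have := cl x y; have := xP 0%N; have := yP 0%N.
rewrite /= {1}/W {1}/H expr0 !divr1 => -> -> /(_ isT isT) [p [c [q D]]].
(* Half of [e] offsets the factor 2 in [rect_int_local]. *)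
have e4 : 0 < e / 2 by rewrite divr_gt0.
have [d d0 {}D] := D _ e4.
have [n nd] : exists n, W n + H n < d.
  have : (fun n => (w + h) * (2^-1) ^+ n) @ \oo --> ((w + h) * 0 : R).
    by apply: cvgMr; apply: cvg_expr; rewrite ger0_norm// invf_lt1// ltr1n.
  rewrite mulr0 => /cvgrPdist_lt/(_ _ d0) [N _ /(_ N (leqnn _))].
  rewrite sub0r normrN => hN; exists N; apply: le_lt_trans hN.
  by rewrite exprVn mulrDl ler_norm.
have [z1 z2 z3 z4] := okZ n; apply/negP; rewrite -leNgt.
have -> : e = 2 * (e / 2) by field.
apply: (@rect_int_local P Q _ _ _ _ x y _ d) => //.
- by move=> x' y' xx yy; apply: cl; lra.
- by exists p, c, q.
Qed.

End goursat.

(** * Complex differentiability *)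

Section complex_derivative.
Context {R : realType}.
Local Notation C := R[i].
Implicit Types (f g k : C -> C) (z : C).

Definition cderivable f z := derivable (f : C^o -> C^o) z 1.

Lemma normC_normc z : `|z| = (ComplexField.Normc.normc z)%:C.
Proof. by case: z => x y; rewrite normc_def. Qed.

Lemma normc_ReIm z : ComplexField.Normc.normc z <= `|complex.Re z| + `|complex.Im z|.
Proof.
case: z => x y /=.
rewrite -[leRHS]ger0_norm ?addr_ge0// -[leRHS]sqrtr_sqr ler_wsqrtr// sqrrD !real_normK ?num_real//.
by rewrite -addrA lerD2l lerDr mulrn_wge0// mulr_ge0.
Qed.

Lemma normc_geRe z : `|complex.Re z| <= ComplexField.Normc.normc z.
Proof.
by case: z => x y /=; rewrite -sqrtr_sqr ler_wsqrtr// lerDl sqr_ge0.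
Qed.

Lemma normc_geIm z : `|complex.Im z| <= ComplexField.Normc.normc z.
Proof.
by case: z => x y /=; rewrite -sqrtr_sqr ler_wsqrtr// lerDr sqr_ge0.
Qed.

Lemma normc_ge0 z : 0 <= ComplexField.Normc.normc z.
Proof. by case: z => x y; exact: sqrtr_ge0. Qed.

Lemma sqr_normcE z :
  ComplexField.Normc.normc z ^+ 2 = complex.Re z ^+ 2 + complex.Im z ^+ 2.
Proof. by case: z => x y /=; rewrite sqr_sqrtr// addr_ge0// sqr_ge0. Qed.

Lemma normc_opp z : ComplexField.Normc.normc (- z) = ComplexField.Normc.normc z.
Proof. by case: z => x y /=; rewrite !sqrrN. Qed.

(** Restates the limit of the difference quotients as a first-order expansion in real increments,
    the form that [closed_at] requires. *)
Lemma cderivable_approx f z : cderivable f z -> exists l : C, forall e : R, 0 < e ->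
  exists2 d : R, 0 < d & forall s t : R, `|s| < d -> `|t| < d ->
    ComplexField.Normc.normc (f (z + (s +i* t)) - f z - l * (s +i* t)) <=
    e * (`|s| + `|t|).
Proof.
move=> /cvg_ex[/= l fl]; exists l => e e0.
have eC0 : 0 < e%:C :> C by rewrite ltcR.
have := fl => /cvgrPdist_le/(_ _ eC0).
rewrite /at_right near_withinE => /nbhs_ballP[/= D D0 HD].
(* The radius is an element of [R[i]]; being positive there, it is real. *)
have [d Dd] : exists d : R, D = d%:C.
  by apply/complex_realP; rewrite realE ltW.
have d0 : 0 < d by rewrite -ltcR -Dd.
exists (d / 2); first by rewrite divr_gt0.
move=> s t sd td; set h := s +i* t.
have hst : ComplexField.Normc.normc h <= `|s| + `|t| by exact: (normc_ReIm h).
(* The limit is over a punctured neighbourhood and says nothing about a zero increment. *)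
have [->|h0] := eqVneq h 0.
  by rewrite addr0 subrr mulr0 subrr ComplexField.Normc.normc0 mulr_ge0 ?addr_ge0// ltW.
have := HD h; rewrite /ball/= sub0r normrN normC_normc Dd ltcR => /(_ _ h0).
have hd : ComplexField.Normc.normc h < d.
  by rewrite (le_lt_trans hst)//; lra.
move=> /(_ hd); rewrite normC_normc lecR => Hh.
apply: (@le_trans _ _ (e * ComplexField.Normc.normc h)); last first.
  by rewrite ler_wpM2l// ltW.
apply: le_trans (ler_wpM2r (normc_ge0 h) Hh).
rewrite -ComplexField.Normc.normcM.
rewrite -[leLHS]normc_opp le_eqVlt; apply/orP; left; apply/eqP.
congr ComplexField.Normc.normc.
rewrite /= /GRing.scale /= mulr1 [h + z]addrC mulrBl mulrAC mulVf// mul1r.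
by rewrite !opprB.
Qed.

(** The Cauchy-Riemann equations: for k = u + iv, the forms u dx - v dy and v dx + u dy are the real
    and imaginary parts of k dz. If k' = p + iq, the common mixed coefficient is -q for the first
    and p for the second. *)
Lemma cderivable_closed k x y : cderivable k (x +i* y) ->
  closed_at (fun s t => complex.Re (k (s +i* t))) (fun s t => - complex.Im (k (s +i* t))) x y /\
  closed_at (fun s t => complex.Im (k (s +i* t))) (fun s t => complex.Re (k (s +i* t))) x y.
Proof.
move=> /cderivable_approx [[p q] H].
have K e : 0 < e -> exists2 d, 0 < d & forall s t : R, `|s| < d -> `|t| < d ->
   `|complex.Re (k ((x + s) +i* (y + t))) - complex.Re (k (x +i* y)) - p * s - (- q) * t|
      <= e * (`|s| + `|t|) /\
   `|complex.Im (k ((x + s) +i* (y + t))) - complex.Im (k (x +i* y)) - q * s - p * t|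
      <= e * (`|s| + `|t|).
  move=> /H [d d0 {}H]; exists d => // s t /H /[apply] {}H.
  have -> : (x + s) +i* (y + t) = (x +i* y) + (s +i* t) by [].
  move: H; case: (k _) => u1 v1; case: (k _) => u v H; split.
  - apply: le_trans H; apply: le_trans (normc_geRe _) => /=.
    by rewrite le_eqVlt; apply/orP; left; apply/eqP; congr `|_|; ring.
  - apply: le_trans H; apply: le_trans (normc_geIm _) => /=.
    by rewrite le_eqVlt; apply/orP; left; apply/eqP; congr `|_|; ring.
split.
- exists p, (- q), (- p) => e /K [d d0 {}K]; exists d => // s t sd td.
  have [h1 h2] := K s t sd td; split=> //.
  by rewrite -normrN; move: h2; congr (`|_| <= _); ring.
- exists q, p, (- q) => e /K [d d0 {}K]; exists d => // s t sd td.
  by have [h1 h2] := K s t sd td; split=> //.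
Qed.

Lemma cderivable_continuous_vert f x y : cderivable f (x +i* y) ->
  {for y, continuous (fun t => complex.Re (f (x +i* t)))} /\
  {for y, continuous (fun t => complex.Im (f (x +i* t)))}.
Proof.
move=> /cderivable_closed [h1 h2]; split; last first.
  have := closed_at_continuousQ2 h1 => /= h.
  rewrite (_ : (fun _ => _) = (fun t => - - complex.Im (f (x +i* t)))).
    exact: cvgN.
  by apply/funext => t; rewrite opprK.
exact: (closed_at_continuousQ2 h2).
Qed.

Lemma cderivable_continuous_hor f x y : cderivable f (x +i* y) ->
  {for x, continuous (fun s => complex.Re (f (s +i* y)))} /\
  {for x, continuous (fun s => complex.Im (f (s +i* y)))}.
Proof.
move=> /cderivable_closed [h1 h2]; split.
  exact: (closed_at_continuousP1 h1).
exact: (closed_at_continuousP1 h2).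
Qed.

Lemma cderivable_shift f c z : cderivable f (z + c) ->
  cderivable (fun z => f (z + c)) z.
Proof.
rewrite /cderivable /derivable /=.
by under [X in _ -> cvg (X @ _)]eq_fun do rewrite -addrA.
Qed.

Lemma cderivableM f g z : cderivable f z -> cderivable g z ->
  cderivable (fun z => f z * g z) z.
Proof. exact: derivableM. Qed.

Lemma cderivableD f g z : cderivable f z -> cderivable g z ->
  cderivable (fun z => f z + g z) z.
Proof. exact: derivableD. Qed.

Lemma analytic_on_cderivable (A : set C) f z : analytic_on A f -> A z -> cderivable f z.
Proof. by move=> af Az; exact: (nbhs_singleton (af z Az)). Qed.

End complex_derivative.

(** * Shifting the contour *)

Section contour_shift.
Context {R : realType}.
Local Notation C := R[i].
Local Notation mu := (@lebesgue_measure R).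
Local Notation normc := ComplexField.Normc.normc.
Implicit Types (f g k : C -> C) (x y N h : R) (P Q : R -> R -> R).

(** By [goursat] on [-N, N] x [0, h], the horizontal sides differ by exactly what the vertical sides
    contribute. *)
Lemma rect_shift_le P Q N h : 0 <= N -> 0 <= h ->
  (forall x y, 0 <= y <= h -> closed_at P Q x y) ->
  `|seg_int (fun x => P x h - P x 0) (- N) (N + N)| <=
  `|seg_int (Q N) 0 h| + `|seg_int (Q (- N)) 0 h|.
Proof.
move=> N0 h0 cl.
have cl' : closed_on P Q (- N) 0 (N + N) h.
  by move=> x y _; rewrite add0r; exact: cl.
have := goursat (addr_ge0 N0 N0) h0 cl'; rewrite /rect_int.
rewrite addKr add0r => H.
have -> : seg_int (fun x => P x h - P x 0) (- N) (N + N) =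
    seg_int (Q N) 0 h - seg_int (Q (- N)) 0 h.
  rewrite -[LHS](@seg_intB _ (P^~ h) (P^~ 0)); first lra.
  - by apply: (closed_onP1 cl'); rewrite add0r h0 lexx.
  - by apply: (closed_onP1 cl'); rewrite add0r h0 lexx.
exact: ler_normB.
Qed.

(** Merges the two uniform limits into one bound in [|x|], which suits rectangles symmetric about
    the imaginary axis. *)
Lemma slice_decayP f : slice_decay f <-> forall e : R, 0 < e ->
  exists M : R, forall x, M <= `|x| -> forall u, - 2^-1 <= u <= 2^-1 ->
    `|slice_energy f x u| < e.
Proof.
have key (F : set_system R) (FF : Filter F) :
    {uniform `[(- 2^-1 : R), 2^-1], slice_energy f @ F --> (fun=> 0 : R)} <->
    forall e : R, 0 < e -> \forall x \near F, forall u, - 2^-1 <= u <= 2^-1 ->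
      `|slice_energy f x u| < e.
  split=> [H e e0|H].
    have := H [set h : R -> R | forall u, - 2^-1 <= u <= 2^-1 -> `|h u| < e].
    apply; apply/uniform_nbhs; exists [set xy | ball xy.1 e xy.2]; split.
      exact: (entourage_ball _ (PosNum e0)).
    move=> k /= Hk u ue; have := Hk u; rewrite /= in_itv/= => /(_ ue).
    by rewrite /ball/= sub0r normrN.
  move=> B /uniform_nbhs[E [entE EB]].
  move: entE; rewrite -entourage_ballE => -[e /= e0 eE].
  have := H e e0; apply: filterS => x xe; apply: EB => u /=; rewrite in_itv/= => ue.
  by apply: eE; rewrite /= /ball/= sub0r normrN; exact: xe.
rewrite /slice_decay (key +oo _) (key -oo _); split=> [[H1 H2] e e0|H].
  have [M1 [_ HM1]] := H1 e e0; have [M2 [_ HM2]] := H2 e e0.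
  (* M1 and M2 may have any sign; the 1 gives the strict inequalities required near infinity. *)
  exists (`|M1| + `|M2| + 1) => x.
  have := ler_norm M1; have := ler_norm (- M2); rewrite normrN => n2 n1.
  have := normr_ge0 M2; have := normr_ge0 M1 => m1 m2.
  case: (ler0P x) => x0 xM u ue.
    by apply: HM2 => //; lra.
  by apply: HM1 => //; lra.
split=> e /H [M HM].
  exists (Num.max M 0); rewrite num_real; split=> // x; rewrite gt_max => /andP[Mx x0].
  by apply: HM; rewrite gtr0_norm// ltW.
exists (Num.min (- M) 0); rewrite num_real; split=> // x; rewrite lt_min => /andP[Mx x0].
by apply: HM; rewrite ltr0_norm//; lra.
Qed.

Lemma sqr_normc_integrable f x u : (forall z, strip z -> cderivable f z) ->
  - 2^-1 <= u <= 2^-1 ->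
  mu.-integrable `[- 2^-1, 2^-1] (EFin \o fun y => normc (f (x +i* (y + u))) ^+ 2).
Proof.
move=> df uu; apply: cont_on_integrable => y yy.
have fz : cderivable f (x +i* (y + u)).
  by apply: df; rewrite /strip/=; lra.
have [c1 c2] := cderivable_continuous_vert fz.
under [X in {for _, continuous X}]eq_fun do rewrite sqr_normcE.
have sh : (fun t => t + u) @ y --> y + u by apply: cvgD; [exact: cvg_id|exact: cvg_cst].
apply: cvgD.
  by rewrite !expr2; apply: cvgM; exact: (cvg_comp _ _ sh c1).
by rewrite !expr2; apply: cvgM; exact: (cvg_comp _ _ sh c2).
Qed.

(** For y in [0, 1/2], the slices u = 0 and u = -1/2 contain the values of f at the heights y and y
    - 1/2, the two that occur in the kernel. *)
Definition side_energy f x : R := slice_energy f x 0 + slice_energy f x (- 2^-1).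

(* Arithmetic-geometric mean inequality on products of a value of f and a value
   of g at the two heights y and y - 1/2. *)
Lemma side_int_le f g x (F : R -> R) :
  (forall z, strip z -> cderivable f z) -> (forall z, strip z -> cderivable g z) ->
  cont_on F 0 2^-1 ->
  (forall y, `|F y| <= normc (f (x +i* y)) * normc (g (x +i* (y - 2^-1))) +
                       normc (f (x +i* (y - 2^-1))) * normc (g (x +i* y))) ->
  `|seg_int F 0 2^-1| <= 2^-1 * (side_energy f x + side_energy g x).
Proof.
move=> df dg cF FE; rewrite /seg_int add0r.
have u0 : - 2^-1 <= (0 : R) <= 2^-1 by lra.
have u1 : - 2^-1 <= (- 2^-1 : R) <= 2^-1 by lra.
have f0 := sqr_normc_integrable x df u0; have f1 := sqr_normc_integrable x df u1.
have g0 := sqr_normc_integrable x dg u0; have g1 := sqr_normc_integrable x dg u1.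
have iF := cont_on_integrable cF.
apply: le_trans; first exact: le_normr_Rintegral.
pose Ef u y : R := normc (f (x +i* (y + u))) ^+ 2.
pose Eg u y : R := normc (g (x +i* (y + u))) ^+ 2.
pose S y : R := (Ef 0 y + Ef (- 2^-1) y) + (Eg 0 y + Eg (- 2^-1) y).
have mD : measurable `[- (2^-1 : R), 2^-1] by [].
have iS : mu.-integrable `[- 2^-1, 2^-1] (EFin \o S).
  exact: (integrableD _ (integrableD _ f0 f1) (integrableD _ g0 g1)).
have -> : side_energy f x + side_energy g x = \int[mu]_(y in `[- 2^-1, 2^-1]) S y.
  rewrite RintegralD//; first 1 last.
  - exact: (integrableD _ f0 f1).
  - exact: (integrableD _ g0 g1).
  by rewrite !RintegralD.
rewrite -RintegralZl//.
apply: (@le_trans _ _ (\int[mu]_(y in `[0, 2^-1]) (2^-1 * S y))).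
  apply: le_Rintegral => //.
  - exact: (integrable_norm iF).
  - apply: (integrableS _ _ _ (integrableZl _ (2^-1) iS)) => //.
    by move=> y /=; rewrite !in_itv/=; lra.
  move=> y _; apply: (le_trans (FE y)).
  rewrite /S /Ef /Eg addr0.
  set a := normc _; set b := normc _; set c := normc _; set d := normc _.
  have := sqr_ge0 (a - b); have := sqr_ge0 (c - d); nra.
have iS' : mu.-integrable `[- (2^-1 : R), 2^-1] (EFin \o (fun y => 2^-1 * S y)).
  exact: (integrableZl _ _ iS).
have sD : `[0, 2^-1] `<=` `[- (2^-1 : R), 2^-1].
  by move=> y /=; rewrite !in_itv/=; lra.
have iS0 : mu.-integrable `[0, 2^-1] (EFin \o (fun y => 2^-1 * S y)).
  apply: (@integrableS _ _ _ mu _ _ _ mD _ sD iS').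
  exact: measurable_itv.
have S0 y : 0 <= S y by rewrite /S /Ef /Eg !addr_ge0// sqr_ge0.
(* As S is nonnegative, enlarging [0, 1/2] to [-1/2, 1/2] can only increase the integral. *)
rewrite /Rintegral fine_le//.
- exact: integrable_fin_num.
- exact: integrable_fin_num.
- apply: ge0_subset_integral => //; first exact: (measurable_int mu).
  by move=> y _; rewrite lee_fin mulr_ge0.
Qed.


(** The truncations of v to [-n, n] are dominated by |v|, so their integrals, which become
    arbitrarily small, converge to the full integral. *)
Lemma Rintegral_eq0_exhaust (v : R -> R) : mu.-integrable setT (EFin \o v) ->
  (forall e : R, 0 < e -> exists M : R, forall n : R, M <= n -> 0 <= n ->
     `|seg_int v (- n) (n + n)| <= e) ->
  \int[mu]_x v x = 0.
Proof.
move=> iv H.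
pose D n : set R := [set` `[- n%:R, n%:R]].
pose vn n : R -> \bar R := (EFin \o v) \_ (D n).
have mv := measurable_int mu iv.
have mD n : measurable (D n) by exact: measurable_itv.
have ivn n : mu.-integrable setT (vn n).
  refine (iffLR (@integrable_mkcond _ _ _ mu _ (EFin \o v) (mD n)) _).
  by apply: (@integrableS _ _ _ mu _ _ _ measurableT (mD n) _ iv).
have [_ _] : [/\ mu.-integrable setT (EFin \o v),
    [sequence (\int[mu]_x `|vn n x - (EFin \o v) x|)%E]_n @ \oo --> 0%E &
    [sequence (\int[mu]_x vn n x)%E]_n @ \oo --> (\int[mu]_x (EFin \o v) x)%E].
  apply: (@dominated_convergence _ _ _ mu _ measurableT vn _ (abse \o (EFin \o v))) => //.
  - by move=> n; exact: (measurable_int mu (ivn n)).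
  - apply: aeW => x _; apply: cvg_near_cst; near=> n.
    rewrite /vn /patch mem_set// /D /= in_itv/=.
    have : `|x| <= n%:R by near: n; exact: nbhs_infty_ger.
    by rewrite ler_norml.
  - exact: integrable_abse.
  - apply: aeW => x n _; rewrite /vn /patch; case: ifPn => // _.
    by rewrite abse0 abse_ge0.
have -> : [sequence (\int[mu]_x vn n x)%E]_n =
    (fun n => (seg_int v (- n%:R) (n%:R + n%:R))%:E).
  apply/funext => n /=; rewrite /vn -integral_mkcond /seg_int addKr /Rintegral fineK//.
  by apply: integrable_fin_num => //; exact: (integrableS measurableT _ _ iv).
have ifin : (\int[mu]_x (EFin \o v) x)%E \is a fin_num by exact: integrable_fin_num.
rewrite -(fineK ifin) => /fine_cvgP[_] /cvgrPdist_le C.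
(* The factor 2 collects one [e] from the convergence and one from the hypothesis on truncated
   integrals. *)
apply/eqP; rewrite -normr_le0; apply: (@le0_scaled_eps _ _ 2) => // e e0.
have [M HM] := H e e0; have [N _ HN] := C e e0.
have [n nM] : exists n : nat, (N <= n)%N /\ M <= n%:R.
  exists (maxn N (Num.Def.trunc `|M|).+1); split; first exact: leq_maxl.
  rewrite (le_trans (ler_norm M))// ltW// (lt_le_trans (truncnS_gt _))//.
  by rewrite ler_nat leq_maxr.
have h1 := HN n nM.1; have h2 := HM n%:R nM.2 (ler0n _ _).
rewrite /Rintegral.
move: h1 h2; rewrite /= !ler_norml; lra.
Unshelve. all: by end_near. Qed.

Definition skew_kernel f g z : C :=
  f z * g (z - 'i%C / 2) + f (z - 'i%C / 2) * g z.

Lemma i_half : 'i%C / 2 = 0 +i* 2^-1 :> C.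
Proof.
have -> : (2 : C) = (2 : R)%:C by rewrite rmorph_nat.
by rewrite -fmorphV; congr (_ +i* _); rewrite /= ?mul0r ?mul1r ?mulr0 ?subr0 ?add0r.
Qed.

(** At z = x + i/2 the arguments z - i/2 fall back on the real line, so g(x) and f(x) factor out of
    the central differences of f and g. *)
Lemma skew_kernel_jump f g x :
  skew_kernel f g (x +i* 2^-1) - skew_kernel f g (x +i* 0) =
  'i%C * (on_line (central_diff f) x * on_line g x +
          on_line f x * on_line (central_diff g) x).
Proof.
rewrite /skew_kernel /on_line /central_diff.
have i0 : 'i%C != 0 :> C by rewrite eq_complex/= oner_eq0 andbF.
have -> : x +i* 2^-1 = x%:C + 'i%C / 2 :> C by rewrite i_half; apply/eqP; rewrite eq_complex /= addr0 add0r !eqxx.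
rewrite -[x +i* 0]/(x%:C) addrK; field.
exact: i0.
Qed.

Lemma skew_kernel_cderivable f g x y :
  (forall z, strip z -> cderivable f z) -> (forall z, strip z -> cderivable g z) ->
  0 <= y <= 2^-1 -> cderivable (skew_kernel f g) (x +i* y).
Proof.
move=> df dg yy.
have s1 : strip (x +i* y) by rewrite /strip/=; lra.
have s2 : strip (x +i* y - 'i%C / 2) by rewrite i_half /strip/=; lra.
apply: cderivableD; apply: cderivableM.
- exact: df.
- exact/cderivable_shift/dg.
- exact/cderivable_shift/df.
- exact: dg.
Qed.

Lemma normc_skew_kernel f g x y : normc (skew_kernel f g (x +i* y)) <=
  normc (f (x +i* y)) * normc (g (x +i* (y - 2^-1))) +
  normc (f (x +i* (y - 2^-1))) * normc (g (x +i* y)).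
Proof.
have -> : x +i* (y - 2^-1) = x +i* y - 'i%C / 2.
  by rewrite i_half; apply/eqP; rewrite eq_complex /= subr0 !eqxx.
by rewrite -!ComplexField.Normc.normcM -lecR rmorphD /= -!normC_normc ler_normD.
Qed.

(** Integrates the jump formula over the line. The real and imaginary parts are treated separately,
    each through one of the closed forms of [cderivable_closed]. *)
Lemma central_diff_skew f g :
  analytic_on strip f -> analytic_on strip g ->
  slice_decay f -> slice_decay g ->
  cintegrable (fun x => on_line (central_diff f) x * on_line g x) ->
  cintegrable (fun x => on_line f x * on_line (central_diff g) x) ->
  inner (on_line (central_diff f)) (on_line g) =
  - inner (on_line f) (on_line (central_diff g)).
Proof.
move=> /analytic_on_cderivable df /analytic_on_cderivable dg.
move=> /slice_decayP sf /slice_decayP sg.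
pose A x := on_line (central_diff f) x * on_line g x.
pose B x := on_line f x * on_line (central_diff g) x.
rewrite -/A -/B => -[rA iA] [rB iB].
pose k := skew_kernel f g.
have dk x y : 0 <= y <= 2^-1 -> cderivable k (x +i* y).
  by move=> yy; exact: skew_kernel_cderivable.
have h0 : (0 : R) <= 2^-1 by lra.
have small e : 0 < e -> exists M : R, forall n : R, M <= n -> 0 <= n ->
    2^-1 * (side_energy f n + side_energy g n) +
    2^-1 * (side_energy f (- n) + side_energy g (- n)) <= e.
  (* Eight slice energies occur, each with weight 1/2. *)
  move=> e0; have e4 : 0 < e / 4 by lra.
  have [M1 H1] := sf _ e4; have [M2 H2] := sg _ e4.
  exists (Num.max M1 M2) => n; rewrite ge_max => /andP[n1 n2] n0.
  have nn : `|n| = n by rewrite ger0_norm.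
  have nN : `|- n| = n by rewrite normrN.
  have U0 : - 2^-1 <= (0 : R) <= 2^-1 by lra.
  have U1 : - 2^-1 <= (- 2^-1 : R) <= 2^-1 by lra.
  have := H1 n; rewrite nn => /(_ n1) K1; have := H1 (- n); rewrite nN => /(_ n1) K2.
  have := H2 n; rewrite nn => /(_ n2) K3; have := H2 (- n); rewrite nN => /(_ n2) K4.
  rewrite /side_energy.
  have := ler_norm (slice_energy f n 0); have := K1 _ U0.
  have := ler_norm (slice_energy f n (- 2^-1)); have := K1 _ U1.
  have := ler_norm (slice_energy f (- n) 0); have := K2 _ U0.
  have := ler_norm (slice_energy f (- n) (- 2^-1)); have := K2 _ U1.
  have := ler_norm (slice_energy g n 0); have := K3 _ U0.
  have := ler_norm (slice_energy g n (- 2^-1)); have := K3 _ U1.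
  have := ler_norm (slice_energy g (- n) 0); have := K4 _ U0.
  have := ler_norm (slice_energy g (- n) (- 2^-1)); have := K4 _ U1.
  lra.
(* The common argument for both closed forms: the integral of the jump of P is bounded by side
   integrals of Q, which the energies control since |Q| is at most |k|. *)
have side P Q : (forall x y, 0 <= y <= 2^-1 -> closed_at P Q x y) ->
    (forall x y, `|Q x y| <= normc (k (x +i* y))) ->
    mu.-integrable setT (EFin \o (fun x => P x 2^-1 - P x 0)) ->
    \int[mu]_x (P x 2^-1 - P x 0) = 0.
  move=> cl Qk iP; apply: Rintegral_eq0_exhaust => // e /small [M HM].
  exists M => n Mn n0; apply: le_trans (HM n Mn n0).
  apply: le_trans (rect_shift_le n0 h0 cl) _.
  apply: lerD; apply: side_int_le => //.
  - by move=> y yy; apply: closed_at_continuousQ2 (cl n y yy).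
  - by move=> y; apply: (le_trans (Qk _ _)); exact: normc_skew_kernel.
  - by move=> y yy; apply: closed_at_continuousQ2 (cl (- n) y yy).
  - by move=> y; apply: (le_trans (Qk _ _)); exact: normc_skew_kernel.
have jump x : k (x +i* 2^-1) - k (x +i* 0) = 'i%C * (A x + B x).
  exact: skew_kernel_jump.
(* Multiplication by i swaps the parts: the real part of the jump carries the imaginary parts of A
   and B, and conversely. *)
have reE x : complex.Re (k (x +i* 2^-1)) - complex.Re (k (x +i* 0)) =
    (-1) * (complex.Im (A x) + complex.Im (B x)).
  move: (jump x); case: (k _) => a b; case: (k _) => c d; case: (A x) => a1 a2.
  by case: (B x) => b1 b2 [/= -> _]; ring.
have imE x : complex.Im (k (x +i* 2^-1)) - complex.Im (k (x +i* 0)) =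
    complex.Re (A x) + complex.Re (B x).
  move: (jump x); case: (k _) => a b; case: (k _) => c d; case: (A x) => a1 a2.
  by case: (B x) => b1 b2 [/= _ ->]; ring.
have iIm : mu.-integrable setT (EFin \o (fun x => complex.Im (A x) + complex.Im (B x))).
  exact: (integrableD _ iA iB).
have iRe : mu.-integrable setT (EFin \o (fun x => complex.Re (A x) + complex.Re (B x))).
  exact: (integrableD _ rA rB).
have I1 : \int[mu]_x (complex.Im (A x) + complex.Im (B x)) = 0.
  have := side _ _ (fun x y yy => (cderivable_closed (dk x y yy)).1).
  under eq_Rintegral do rewrite reE.
  rewrite RintegralZl// mulN1r => /(_ _ _)/eqP; rewrite oppr_eq0 => I.
  apply/eqP/I => [x y|]; first by rewrite normrN; exact: normc_geIm.
  under [X in EFin \o X]eq_fun do rewrite reE.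
  exact: (integrableZl _ (-1) iIm).
have I2 : \int[mu]_x (complex.Re (A x) + complex.Re (B x)) = 0.
  have := side _ _ (fun x y yy => (cderivable_closed (dk x y yy)).2).
  under eq_Rintegral do rewrite imE.
  apply=> [x y|]; first exact: normc_geRe.
  by under [X in EFin \o X]eq_fun do rewrite imE.
rewrite RintegralD// in I1; rewrite RintegralD// in I2.
rewrite /inner -/A -/B; apply/eqP; rewrite eq_complex /= -!addr_eq0.
by apply/andP; split; apply/eqP.
Qed.

End contour_shift.

(** * Test functions *)

Section real_test_functions.
Context {R : realType}.
Local Notation C := R[i].
Local Notation mu := (@lebesgue_measure R).
Local Notation normc := ComplexField.Normc.normc.
Implicit Types (f g : C -> C) (x y c r : R) (z : C).

(* Any width in ]1, 2[ would do: the test functions have poles at height 2. *)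
Definition wide_holomorphic f := forall z, `|complex.Im z| < 3 / 2 -> cderivable f z.

(** Schwarz reflection. It makes f real on the line, and also its central difference, which becomes
    twice the imaginary part of f at height 1/2. *)
Definition conj_equivariant f := forall z, f (z^*) = (f z)^*.

Definition quadratic_decay f := exists K : R, forall z, strip z ->
  normc (f z) <= K / (1 + complex.Re z ^+ 2).

Definition bounded_on_strip f := exists K : R, forall z, strip z -> normc (f z) <= K.

Lemma cderivable_cst (a : C) z : cderivable (fun=> a) z.
Proof. exact: derivable_cst. Qed.

Lemma cderivable_id z : cderivable (fun z => z) z.
Proof. exact: derivable_id. Qed.

Lemma cderivableN f z : cderivable f z -> cderivable (fun z => - f z) z.
Proof. exact: derivableN. Qed.

Lemma cderivableV f z : f z != 0 -> cderivable f z -> cderivable (fun z => (f z)^-1) z.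
Proof. exact: derivableV. Qed.

Lemma cderivableX f n z : cderivable f z -> cderivable (fun z => f z ^+ n) z.
Proof.
move=> df; elim: n => [|n IH]; first exact: cderivable_cst.
by under eq_fun do rewrite exprS; exact: cderivableM.
Qed.

Lemma wide_holomorphic_analytic f : wide_holomorphic f -> analytic_on strip f.
Proof.
move=> df z sz.
(* A disc of radius 1/2 around a point of the strip stays in |Im z| < 3/2. *)
have h0 : 0 < (2^-1)%:C :> C by rewrite ltcR invr_gt0.
apply: filterS (nbhsx_ballx z _ h0) => w; rewrite /ball/= => zw; apply: df.
move: zw; rewrite normC_normc ltcR => zw.
have := le_lt_trans (normc_geIm _) zw; rewrite raddfB/= => zw'.
by move: sz zw'; rewrite /strip/= ltr_norml ltr_norml; lra.
Qed.

Lemma strip_cderivable f z : wide_holomorphic f -> strip z -> cderivable f z.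
Proof. by move=> wf sz; apply: wf; move: sz; rewrite /strip/= ltr_norml; lra. Qed.

Lemma integrable_oneDsqrV :
  mu.-integrable setT (EFin \o (fun x : R => (1 + x ^+ 2)^-1)).
Proof.
apply/integrableP; split.
  apply/measurable_EFinP; apply: continuous_measurable_fun.
  exact: continuous_oneDsqrV.
under eq_integral do rewrite /= ger0_norm ?invr_ge0 ?addr_ge0 ?sqr_ge0//.
rewrite ge0_symfun_integralT//=.
- rewrite (_ : [set x | _] = `[0, +oo[%classic); last first.
    by apply/seteqP; split => x/=; rewrite in_itv/= andbT.
  by have := integral0y_oneDsqr R; rewrite /oneDsqr => ->; rewrite -EFinM ltry.
- by move=> x; rewrite invr_ge0 addr_ge0 ?sqr_ge0.
- exact: continuous_oneDsqrV.
- by move=> x/=; rewrite sqrrN.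
Qed.

(** The square of u is at most K^2 / (1 + x^2)^2, hence at most the integrable K^2 / (1 + x^2). *)
Lemma quadratic_decay_Lfun2 (u : R -> R) K : continuous u ->
  (forall x, `|u x| <= K / (1 + x ^+ 2)) -> u \in Lfun mu 2%:E.
Proof.
move=> cu uK; have mu_ : measurable_fun [set: R] u by exact: continuous_measurable_fun.
rewrite inE; apply/andP; split; rewrite inE//=.
rewrite /finite_norm; apply: (@lty_poweRy _ _ 2) => //.
rewrite poweR_Lnorm//.
have iK : mu.-integrable setT (EFin \o (fun x : R => K ^+ 2 * (1 + x ^+ 2)^-1)).
  exact: (integrableZl _ (K ^+ 2) integrable_oneDsqrV).
have /integrableP[_] := iK; apply: le_lt_trans.
apply: ge0_le_integral => //.
- by move=> x _; exact: poweR_ge0.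
- apply/measurable_EFinP; apply: (measurableT_comp (measurable_powR _)).
  exact: measurableT_comp.
- by apply: measurableT_comp => //; exact: (measurable_int mu iK).
move=> x _; rewrite /= lee_fin powR_mulrn//.
apply: (le_trans _ (ler_norm _)).
have d0 : 0 < 1 + x ^+ 2 by rewrite ltr_pwDl// sqr_ge0.
apply: (@le_trans _ _ ((K / (1 + x ^+ 2)) ^+ 2)).
  by rewrite lerXn2r// nnegrE ?(le_trans _ (uK x)).
rewrite expr_div_n ler_wpM2l ?sqr_ge0// lef_pV2 ?posrE ?exprn_gt0//.
by rewrite [leRHS]expr2 ler_peMl// ?lerDl ?sqr_ge0// ltW.
Qed.

Lemma quadratic_decay_slice f : wide_holomorphic f -> quadratic_decay f -> slice_decay f.
Proof.
move=> wf [K fK]; apply/slice_decayP => e e0.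
(* The 1 ensures |x| >= 1, so that x^2 >= |x| > K^2 / e. *)
exists (K ^+ 2 / e + 1) => x xM u uu.
have x1 : 1 <= `|x|.
  by rewrite (le_trans _ xM)// lerDr divr_ge0// ?sqr_ge0// ltW.
have d0 : 0 < 1 + x ^+ 2 by rewrite ltr_pwDl// sqr_ge0.
have Kx2 : K ^+ 2 / (1 + x ^+ 2) < e.
  rewrite ltr_pdivrMr// mulrC -ltr_pdivrMr//.
  have : K ^+ 2 / e < `|x| by apply: lt_le_trans xM; rewrite ltrDl.
  have : x ^+ 2 = `|x| ^+ 2 by rewrite real_normK ?num_real.
  by move=> ->; rewrite expr2; nra.
apply: le_lt_trans Kx2.
have -> : slice_energy f x u =
    seg_int (fun y => normc (f (x +i* (y + u))) ^+ 2) (- 2^-1) 1.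
  by rewrite /seg_int (_ : - 2^-1 + 1 = 2^-1 :> R)//; lra.
(* Prepares [seg_int_approx] with the constant 0 on a segment of width 1. *)
rewrite -[X in `|X|]subr0 -[X in `|_ - X|](mul0r 1) -[leRHS]mulr1.
apply: seg_int_approx => //.
  move=> y yy; have fz : cderivable f (x +i* (y + u)).
    by apply: strip_cderivable => //; rewrite /strip/=; lra.
  have [c1 c2] := cderivable_continuous_vert fz.
  under [X in {for _, continuous X}]eq_fun do rewrite sqr_normcE.
  have sh : (fun t => t + u) @ y --> y + u by apply: cvgD; [exact: cvg_id|exact: cvg_cst].
  apply: cvgD.
    by rewrite !expr2; apply: cvgM; exact: (cvg_comp _ _ sh c1).
  by rewrite !expr2; apply: cvgM; exact: (cvg_comp _ _ sh c2).
move=> y yy; rewrite subr0 ger0_norm ?sqr_ge0//.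
have sz : strip (x +i* (y + u)) by rewrite /strip/=; lra.
have := fK _ sz => /= fz.
apply: (@le_trans _ _ ((K / (1 + x ^+ 2)) ^+ 2)).
  by rewrite lerXn2r// nnegrE ?normc_ge0// (le_trans _ fz)// normc_ge0.
rewrite expr_div_n ler_wpM2l ?sqr_ge0// lef_pV2 ?posrE ?exprn_gt0//.
by rewrite [leRHS]expr2 ler_peMl// ?lerDl ?sqr_ge0// ltW.
Qed.

Lemma conj_equivariant_real f x : conj_equivariant f -> complex.Im (f x%:C) = 0.
Proof.
move=> /(_ x%:C); rewrite conjc_real; case: (f _) => a b [] /eqP.
rewrite -subr_eq0 opprK => /eqP bb /=; lra.
Qed.

Lemma conj_equivariant_central_diff f x : conj_equivariant f ->
  on_line (central_diff f) x = (2 * complex.Im (f (x +i* 2^-1)))%:C.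
Proof.
move=> cf; rewrite /on_line /central_diff.
have -> : x%:C + 'i%C / 2 = x +i* 2^-1 :> C.
  by rewrite i_half; apply/eqP; rewrite eq_complex /= addr0 add0r !eqxx.
have -> : x%:C - 'i%C / 2 = (x +i* 2^-1)^* :> C.
  by rewrite i_half; apply/eqP; rewrite eq_complex /= subr0 add0r !eqxx.
have i0 : 'i%C != 0 :> C by rewrite eq_complex/= oner_eq0 andbF.
rewrite cf; apply: (mulIf i0); rewrite divfK//.
case: (f _) => a b; apply/eqP; rewrite eq_complex /=.
by apply/andP; split; apply/eqP; ring.
Qed.

Lemma test_function_dom_T f : wide_holomorphic f -> conj_equivariant f ->
  quadratic_decay f -> dom_T f.
Proof.
move=> wf cf qf; have [K fK] := qf.
have hor y x : - 1 <= y <= 1 -> {for x, continuous (fun x => complex.Re (f (x +i* y)))} /\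
    {for x, continuous (fun x => complex.Im (f (x +i* y)))}.
  by move=> yy; apply: cderivable_continuous_hor; apply: strip_cderivable.
split.
- split.
  + exact: wide_holomorphic_analytic.
  + exact: quadratic_decay_slice.
  + by move=> x; exact: conj_equivariant_real.
- exists (fun x => complex.Re (f (x +i* 0))).
    apply: (@quadratic_decay_Lfun2 _ K) => x; first by apply: (hor 0 x _).1; lra.
    apply: (le_trans (normc_geRe _)); apply: (fK (x +i* 0)); rewrite /strip/=; lra.
  move=> x; rewrite /on_line -[x +i* 0]/(x%:C).
  by have := conj_equivariant_real x cf; case: (f _) => a b /= ->.
- exists (fun x => 2 * complex.Im (f (x +i* 2^-1))).
    apply: (@quadratic_decay_Lfun2 _ (2 * K)) => x.
      apply: cvgM; first exact: cvg_cst.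
      by apply: (hor 2^-1 x _).2; lra.
    rewrite normrM ger0_norm// -mulrA ler_pM2l//.
    apply: (le_trans (normc_geIm _)); apply: (fK (x +i* 2^-1)); rewrite /strip/=; lra.
  by move=> x; exact: conj_equivariant_central_diff.
Qed.

End real_test_functions.

(** * Lorentzians and the bump functions made from them *)

Section lorentzian.
Context {R : realType}.
Local Notation C := R[i].
Local Notation mu := (@lebesgue_measure R).
Local Notation normc := ComplexField.Normc.normc.
Implicit Types (f g : C -> C) (x y c r : R) (z : C).

(** Multipliers that preserve [decaying_test], closed under the operations from which [half_step] is
    built. *)
Definition bounded_test f :=
  [/\ wide_holomorphic f, conj_equivariant f & bounded_on_strip f].

Definition decaying_test f :=
  [/\ wide_holomorphic f, conj_equivariant f & quadratic_decay f].

Lemma bounded_test_real (a : R) : bounded_test (fun=> a%:C).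
Proof.
split; first by move=> z _; exact: cderivable_cst.
- by move=> z; rewrite conjc_real.
- by exists (normc a%:C).
Qed.

Lemma bounded_testM f g : bounded_test f -> bounded_test g ->
  bounded_test (fun z => f z * g z).
Proof.
move=> [wf cf [K fK]] [wg cg [L gL]]; split.
- by move=> z zz; apply: cderivableM; [exact: wf|exact: wg].
- by move=> z; rewrite cf cg rmorphM.
- exists (K * L) => z zs; rewrite ComplexField.Normc.normcM.
  by apply: ler_pM; rewrite ?normc_ge0 ?fK ?gL.
Qed.

Lemma bounded_testX f n : bounded_test f -> bounded_test (fun z => f z ^+ n).
Proof.
move=> tf; elim: n => [|n IH]; first exact: (bounded_test_real 1).
by under eq_fun do rewrite exprS; exact: bounded_testM.
Qed.

Lemma bounded_test1B f : bounded_test f -> bounded_test (fun z => 1 - f z).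
Proof.
move=> [wf cf [K fK]]; split.
- move=> z zz; apply: cderivableD; first exact: cderivable_cst.
  exact/cderivableN/wf.
- by move=> z; rewrite cf rmorphB rmorph1.
- exists (1 + K) => z zs; rewrite -lecR -normC_normc rmorphD/=.
  apply: le_trans (ler_normB _ _) _; rewrite normr1 lerD2l normC_normc lecR.
  exact: fK.
Qed.

Lemma decaying_testM f g : decaying_test f -> bounded_test g ->
  decaying_test (fun z => f z * g z).
Proof.
move=> [wf cf [K fK]] [wg cg [L gL]]; split.
- by move=> z zz; apply: cderivableM; [exact: wf|exact: wg].
- by move=> z; rewrite cf cg rmorphM.
- exists (K * L) => z zs; rewrite ComplexField.Normc.normcM mulrAC.
  by apply: ler_pM; rewrite ?normc_ge0 ?fK ?gL.
Qed.

(** The poles are c + 2i and c - 2i, away from the strip. *)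
Definition lorentz c z : C := (4 + (z - c%:C) ^+ 2)^-1.

Definition rlorentz c x : R := (4 + (x - c) ^+ 2)^-1.

Lemma lorentz_line c x : lorentz c x%:C = (rlorentz c x)%:C.
Proof. by rewrite fmorphV rmorphD rmorphXn rmorphB rmorph_nat. Qed.

Lemma lorentz_denom_Re c z : complex.Re (4 + (z - c%:C) ^+ 2) =
  4 + (complex.Re z - c) ^+ 2 - complex.Im z ^+ 2.
Proof.
have -> : (4 : C) = (4 : R)%:C by rewrite rmorph_nat.
by case: z => x y; rewrite !expr2 /=; ring.
Qed.

(** In the strip the denominator already has real part at least 3 + (Re z - c)^2. *)
Lemma lorentz_bound c z : strip z -> normc (lorentz c z) <= (1 + (complex.Re z - c) ^+ 2)^-1.
Proof.
move=> zs; rewrite ComplexField.Normc.normcV.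
have d0 : 0 < 1 + (complex.Re z - c) ^+ 2 by rewrite ltr_pwDl// sqr_ge0.
have le : 1 + (complex.Re z - c) ^+ 2 <= normc (4 + (z - c%:C) ^+ 2).
  apply: (le_trans _ (normc_geRe _)); apply: (le_trans _ (ler_norm _)).
  rewrite lorentz_denom_Re; move: zs; rewrite /strip/=.
  set y := complex.Im z => yy; have y2 : y ^+ 2 <= 1 by rewrite expr2; nra.
  lra.
by rewrite lef_pV2// posrE// (lt_le_trans d0).
Qed.

Lemma lorentz_wide_holomorphic c : wide_holomorphic (lorentz c).
Proof.
move=> z; rewrite ltr_norml => zz; apply: cderivableV.
  (* The denominator does not vanish: its real part exceeds 4 - 9/4. *)
  apply/eqP => /(congr1 (@complex.Re R)); rewrite lorentz_denom_Re /=.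
  have := sqr_ge0 (complex.Re z - c); move: zz; set y := complex.Im z => yy.
  by rewrite (expr2 y); nra.
apply: cderivableD; first exact: cderivable_cst.
apply: cderivableX; apply: cderivableD; first exact: cderivable_id.
exact: cderivable_cst.
Qed.

Lemma lorentz_conj c : conj_equivariant (lorentz c).
Proof.
move=> z; rewrite /lorentz fmorphV rmorphD rmorphXn rmorphB rmorph_nat.
by rewrite -[X in _ = (_ + (_ - X) ^+ 2)^-1]/(c%:C^*) conjc_real.
Qed.

Lemma lorentz_bounded_test c : bounded_test (lorentz c).
Proof.
split; [exact: lorentz_wide_holomorphic|exact: lorentz_conj|].
exists 1 => z zs; apply: (le_trans (lorentz_bound c zs)).
by rewrite invf_le1 ?lerDl ?sqr_ge0// ltr_pwDl// sqr_ge0.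
Qed.

Lemma lorentz_decaying_test : decaying_test (lorentz 0).
Proof.
split; [exact: lorentz_wide_holomorphic|exact: lorentz_conj|].
by exists 1 => z zs; have := lorentz_bound 0 zs; rewrite subr0 div1r.
Qed.

(* Approximates the indicator function of ]1/2, 1] on [0, 1] as n grows. *)
Definition half_step (S : pzRingType) n (t : S) : S := 1 - (1 - t ^+ n) ^+ (2 ^ n).

(* The factor makes the inner Lorentzian equal to 1/2 exactly at distance r
   from c. *)
Definition bump c r n z : C :=
  lorentz 0 z * half_step n (((4 + r ^+ 2) / 2)%:C * lorentz c z).

Definition rbump c r n x : R :=
  rlorentz 0 x * half_step n ((4 + r ^+ 2) / 2 * rlorentz c x).

Lemma half_step_line n (t : R) : half_step n (t%:C : C) = (half_step n t)%:C.
Proof. by rewrite /half_step -rmorphXn -(rmorph1 (real_complex R)) -rmorphB -rmorphXn -rmorphB. Qed.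

Lemma bump_line c r n x : bump c r n x%:C = (rbump c r n x)%:C.
Proof. by rewrite /bump !lorentz_line -rmorphM half_step_line -rmorphM. Qed.

Lemma bump_dom_T c r n : dom_T (bump c r n).
Proof.
have [? ? ?] : decaying_test (bump c r n).
  apply: decaying_testM; first exact: lorentz_decaying_test.
  apply/bounded_test1B/bounded_testX/bounded_test1B/bounded_testX.
  by apply: bounded_testM; [exact: bounded_test_real|exact: lorentz_bounded_test].
exact: test_function_dom_T.
Qed.

Lemma bernoulli_inequality (s : R) m : -1 <= s -> 1 + m%:R * s <= (1 + s) ^+ m.
Proof.
move=> s1; elim: m => [|m IH]; first by rewrite mul0r addr0 expr0.
rewrite exprS; apply: (@le_trans _ _ ((1 + s) * (1 + m%:R * s))).
  rewrite -natr1; have : 0 <= m%:R * s ^+ 2 by rewrite mulr_ge0 ?sqr_ge0.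
  by rewrite expr2; lra.
by rewrite ler_wpM2l//; lra.
Qed.

Lemma half_step_ge0_le1 n (t : R) : 0 <= t <= 1 -> 0 <= half_step n t <= 1.
Proof.
move=> /andP[t0 t1]; have := exprn_ge0 n t0; have := exprn_ile1 n t0 t1 => s1 s0.
have p0 : 0 <= 1 - t ^+ n by lra.
have p1 : 1 - t ^+ n <= 1 by lra.
have := exprn_ge0 (2 ^ n) p0; have := exprn_ile1 (2 ^ n) p0 p1.
by rewrite /half_step; lra.
Qed.

(** By Bernoulli's inequality (1 - t^n)^(2^n) >= 1 - (2t)^n, so the value lies between 0 and
    (2t)^n. *)
Lemma half_step_small (t : R) : 0 <= t < 2^-1 -> half_step n t @[n --> \oo] --> (0 : R).
Proof.
move=> /andP[t0 t1].
apply: (@squeeze_cvgr _ _ _ _ (fun=> 0) (fun n => (2 * t) ^+ n)).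
- apply: nearW => n; apply/andP; split.
    by have /andP[] := @half_step_ge0_le1 n t ltac:(lra).
  have := @bernoulli_inequality (- t ^+ n) (2 ^ n).
  have : t ^+ n <= 1 by rewrite exprn_ile1//; lra.
  move=> tn /(_ ltac:(lra)); rewrite /half_step exprMn natrX; lra.
- exact: cvg_cst.
- by apply: cvg_expr; rewrite ger0_norm; lra.
Qed.

(** The product of (1 - t^n)^(2^n) and (1 + t^n)^(2^n) is at most 1, and Bernoulli bounds the second
    factor below by (2t)^n; the first is therefore at most (2t)^(-n). *)
Lemma half_step_large (t : R) : 2^-1 < t <= 1 -> half_step n t @[n --> \oo] --> (1 : R).
Proof.
move=> /andP[t0 t1].
have t2 : 1 < 2 * t by lra.
apply: (@squeeze_cvgr _ _ _ _ (fun n => 1 - ((2 * t)^-1) ^+ n) (fun=> 1)).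
- apply: nearW => n; apply/andP; split; last first.
    by have /andP[] := @half_step_ge0_le1 n t ltac:(lra).
  have s0 : 0 <= t ^+ n by rewrite exprn_ge0//; lra.
  have s1 : t ^+ n <= 1 by rewrite exprn_ile1//; lra.
  have := @bernoulli_inequality (t ^+ n) (2 ^ n) ltac:(lra).
  rewrite natrX -exprMn => B.
  have prod : (1 - t ^+ n) ^+ (2 ^ n) * (1 + t ^+ n) ^+ (2 ^ n) <= 1.
    by rewrite -exprMn exprn_ile1//; nra.
  rewrite /half_step lerD2l lerN2 exprVn.
  have P : 0 < (2 * t) ^+ n by rewrite exprn_gt0//; lra.
  rewrite -[leRHS]mul1r ler_pdivlMr//.
  apply: le_trans prod; rewrite ler_wpM2l ?exprn_ge0//; lra.
- rewrite -[X in _ --> X]subr0; apply: cvgB; first exact: cvg_cst.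
  by apply: cvg_expr; rewrite ger0_norm ?invr_ge0 ?invf_lt1//; lra.
- exact: cvg_cst.
Qed.

End lorentzian.

(** * Density of the domain *)

Section density.
Context {R : realType}.
Local Notation C := R[i].
Local Notation mu := (@lebesgue_measure R).
Implicit Types (c r x : R) (u v h : R -> R).

Lemma Lfun2_mul_integrable u v : u \in Lfun mu 2%:E -> v \in Lfun mu 2%:E ->
  mu.-integrable setT (EFin \o (fun x => u x * v x)).
Proof. by move=> u2 v2; apply/Lfun1_integrable; exact: Lfun2_mul_Lfun1. Qed.

(** When h has integral 0 over a ball around x, the mean of |h - h(x)| there is at least |h(x)|. At
    a Lebesgue point this mean tends to 0 with the radius. *)
Lemma lebesgue_pt_ball_eq0 h x : mu.-integrable setT (EFin \o h) ->
  lebesgue_pt h x ->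
  (forall r, 0 < r <= 2 -> \int[mu]_(y in ball x r) h y = 0) ->
  h x = 0.
Proof.
move=> ih lx H.
apply/eqP; rewrite -normr_le0 -lee_fin.
apply: (cvge_to_ge lx); near=> r.
have r0 : 0 < r by near: r; exact: nbhs_right_gt.
have r2 : r <= 2 by near: r; exact: nbhs_right_le.
have mB : measurable (ball x r : set R) by exact: measurable_ball.
have muB : mu (ball x r) = (r *+ 2)%:E by rewrite lebesgue_measure_ball// ltW.
have ihB : mu.-integrable (ball x r) (EFin \o h).
  by apply: (@integrableS _ _ _ mu _ _ _ measurableT mB _ ih).
have icB : mu.-integrable (ball x r) (EFin \o (fun=> h x)).
  apply/integrableP; split; first exact: measurable_cst.
  by rewrite integral_cst//= muB -EFinM ltry.
have idB : mu.-integrable (ball x r) (EFin \o (fun y => h y - h x)).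
  exact: (integrableB _ ihB icB).
have I : \int[mu]_(y in ball x r) (h y - h x) = - (h x * (r *+ 2)).
  rewrite RintegralB// H ?r0// sub0r Rintegral_cst//.
  by congr (- (_ * _)); exact: (congr1 fine muB).
have d0 : 0 < r *+ 2 by rewrite pmulrn_lgt0.
have key : ((`|h x| * (r *+ 2))%:E <= \int[mu]_(y in ball x r) `|(h y - h x)%:E|)%E.
  rewrite -[X in `|h x| * X]gtr0_norm// -normrM -normrN -I.
  rewrite (@EFin_normr_Rintegral _ _ _ mu _ _ mB idB).
  by apply: le_abse_integral => //; exact: (measurable_int mu idB).
rewrite /davg /iavg muB inver gt_eqF//.
rewrite -[leLHS](mul1e) -(mulVf (lt0r_neq0 d0)) EFinM -muleA lee_pmul2l//.
  by rewrite -EFinM mulrC.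
by rewrite lte_fin invr_gt0.
Unshelve. all: by end_near. Qed.

Lemma rlorentz_Lfun2 : rlorentz 0 \in Lfun mu 2%:E.
Proof.
(* For n = 0, [half_step] is 1 - 0^1 = 1, so this bump is the Lorentzian itself. *)
have [_ [u u2 uE] _] := bump_dom_T (0 : R) 0 0.
rewrite (_ : rlorentz 0 = u)//; apply/funext => x.
apply: complexI; rewrite -uE /on_line bump_line /rbump /half_step.
by rewrite !expr0 subrr subr0 mulr1.
Qed.

Lemma rlorentz_gt0 c x : 0 < rlorentz c x.
Proof. by rewrite invr_gt0 ltr_pwDl// sqr_ge0. Qed.

Lemma rlorentz_half c r x : 0 < r ->
  [/\ `|x - c| < r -> 2^-1 < (4 + r ^+ 2) / 2 * rlorentz c x
    & r < `|x - c| -> (4 + r ^+ 2) / 2 * rlorentz c x < 2^-1].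
Proof.
move=> r0; have p : 0 < 4 + (x - c) ^+ 2 by rewrite ltr_pwDl// sqr_ge0.
rewrite /rlorentz -(real_normK (num_real (x - c))) in p *.
have := normr_ge0 (x - c); set y := `|_| in p * => y0; split=> yr.
  by rewrite ltr_pdivlMr// !expr2; nra.
by rewrite ltr_pdivrMr// !expr2; nra.
Qed.

(** Orthogonality to every bump passes to the limit by dominated convergence, the bumps tending to
    the Lorentzian times the indicator of the ball. *)
Lemma bump_orthogonal v c r : v \in Lfun mu 2%:E ->
  (forall f : C -> C, dom_T f -> \int[mu]_x (complex.Re (f x%:C) * v x) = 0) ->
  0 < r <= 2 -> \int[mu]_(x in ball c r) (rlorentz 0 x * v x) = 0.
Proof.
move=> v2 orth /andP[r0 r2].
have iwv := Lfun2_mul_integrable rlorentz_Lfun2 v2.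
pose t x := (4 + r ^+ 2) / 2 * rlorentz c x.
(* The bound r <= 2 enters here: the maximum of t is (4 + r^2) / 8. *)
have t01 x : 0 <= t x <= 1.
  have p : 0 < 4 + (x - c) ^+ 2 by rewrite ltr_pwDl// sqr_ge0.
  apply/andP; split; first by rewrite mulr_ge0 ?ltW ?rlorentz_gt0// divr_gt0// ltr_pwDl// sqr_ge0.
  rewrite ler_pdivrMr// mul1r; have := sqr_ge0 (x - c).
  have : r ^+ 2 <= 4 by rewrite expr2; nra.
  lra.
pose fn n x : \bar R := (rbump c r n x * v x)%:E.
have ifn n : mu.-integrable setT (fn n).
  have [_ [u u2 uE] _] := bump_dom_T c r n.
  rewrite (_ : fn n = EFin \o (fun x => u x * v x)); first exact: Lfun2_mul_integrable.
  apply/funext => x; rewrite /fn /=; congr (_ * _)%:E.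
  by apply: complexI; rewrite -uE /on_line bump_line.
have fn0 n : (\int[mu]_x fn n x)%E = 0%E.
  rewrite -[LHS]fineK; last exact: integrable_fin_num.
  congr EFin; rewrite -(orth _ (bump_dom_T c r n)).
  by congr fine; apply: eq_integral => x _; rewrite bump_line.
pose wv x : \bar R := (rlorentz 0 x * v x)%:E.
have mB : measurable (ball c r : set R) by exact: measurable_ball.
have iG : mu.-integrable setT (wv \_ (ball c r)).
  refine (iffLR (@integrable_mkcond _ _ _ mu _ wv mB) _).
  by apply: (@integrableS _ _ _ mu _ _ _ measurableT mB _ iwv).
have [_ _] : [/\ mu.-integrable setT (wv \_ (ball c r)),
    [sequence (\int[mu]_x `|fn n x - (wv \_ (ball c r)) x|)%E]_n @ \oo --> 0%E &
    [sequence (\int[mu]_x fn n x)%E]_n @ \oo --> (\int[mu]_x (wv \_ (ball c r)) x)%E].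
  apply: (@dominated_convergence _ _ _ mu _ measurableT fn _ (abse \o wv)) => //.
  - by move=> n; exact: (measurable_int mu (ifn n)).
  - exact: (measurable_int mu iG).
  (* At these two points t = 1/2, which neither limit of [half_step] covers; they form a null
     set. *)
  - exists [set c - r; c + r]; split.
    + exact: measurableU.
    + by rewrite null_set_setU//; exact: lebesgue_measure_set1.
    + move=> x /= Hx; apply: contrapT => xcr; apply: Hx => _.
      have xr : `|x - c| != r.
        apply: contrapT => /negP; rewrite negbK => /eqP xr; apply: xcr => /=.
        by case: (ler0P (x - c)) xr => _ xr; [left|right]; lra.
      rewrite /patch; case: ifPn => [|].
        rewrite inE /ball/= distrC => xB.
        apply: cvg_EFin; first exact: nearW.
        have : rlorentz 0 x * half_step n (t x) * v x @[n --> \oo] -->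
               rlorentz 0 x * 1 * v x.
          apply: cvgMl; apply: cvgMr; apply: half_step_large.
          by have [/(_ xB) + _] := rlorentz_half c x r0; move: (t01 x) => /andP[_ ->]; rewrite andbT.
        by rewrite mulr1.
      rewrite notin_setE /ball/= distrC => /negP; rewrite -leNgt => xB.
      have xB' : r < `|x - c| by rewrite lt_neqAle eq_sym xr.
      apply: cvg_EFin; first exact: nearW.
      have : rlorentz 0 x * half_step n (t x) * v x @[n --> \oo] -->
               rlorentz 0 x * 0 * v x.
        apply: cvgMl; apply: cvgMr; apply: half_step_small.
        by have [_ /(_ xB')] := rlorentz_half c x r0; move: (t01 x) => /andP[-> _].
      by rewrite mulr0 mul0r.
  - exact: (integrable_abse iwv).
  - apply: aeW => x n _; rewrite /fn /wv /= lee_fin !normrM ler_wpM2r//.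
    rewrite -normrM /rbump normrM ler_piMr//.
    by have /andP[q0 q1] := half_step_ge0_le1 n (t01 x); rewrite ger0_norm.
have -> : [sequence (\int[mu]_x fn n x)%E]_n = (fun=> 0%E).
  by apply/funext => n /=; rewrite fn0.
rewrite -integral_mkcond => /cvg_lim => /(_ (@ereal_hausdorff R)).
rewrite lim_cst; last exact: ereal_hausdorff.
by rewrite /Rintegral => <-.
Qed.

(** The product of v and the Lorentzian vanishes at each of its Lebesgue points, hence almost
    everywhere, and the Lorentzian is positive. *)
Lemma dom_T_orthogonal_ae0 v : v \in Lfun mu 2%:E ->
  (forall f : C -> C, dom_T f -> \int[mu]_x (complex.Re (f x%:C) * v x) = 0) ->
  {ae mu, forall x, v x = 0}.
Proof.
move=> v2 orth; have iwv := Lfun2_mul_integrable rlorentz_Lfun2 v2.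
have [N [mN N0 subN]] := lebesgue_differentiation (open_integrable_locally openT iwv).
exists N; split=> // x /= vx; apply: subN => /= lx; apply: vx.
have := lebesgue_pt_ball_eq0 iwv lx (fun r r02 => bump_orthogonal x v2 orth r02).
by move=> /eqP; rewrite mulf_eq0 gt_eqF ?rlorentz_gt0//= => /eqP.
Qed.

End density.

(** * The inner product of real functions, and the adjoint of T *)

Section adjoint.
Context {R : realType}.
Local Notation C := R[i].
Local Notation mu := (@lebesgue_measure R).
Implicit Types (F G H : R -> C) (u v : R -> R).

Lemma Lfun2_real_cintegrable u v F G : u \in Lfun mu 2%:E -> v \in Lfun mu 2%:E ->
  (forall x, F x = (u x)%:C) -> (forall x, G x = (v x)%:C) ->
  cintegrable (fun x => F x * G x).
Proof.
move=> u2 v2 Fu Gv; split; under eq_fun do rewrite Fu Gv -rmorphM/=.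
  exact: Lfun2_mul_integrable.
exact: integrable0.
Qed.

Lemma inner_real u v F G :
  (forall x, F x = (u x)%:C) -> (forall x, G x = (v x)%:C) ->
  inner F G = (\int[mu]_x (u x * v x))%:C.
Proof.
move=> Fu Gv; rewrite /inner; under eq_Rintegral do rewrite Fu Gv -rmorphM/=.
under [X in _ +i* X]eq_Rintegral do rewrite Fu Gv -rmorphM/=.
by congr (_ +i* _); rewrite /Rintegral integral0.
Qed.

End adjoint.

(** Integrability of the two products makes the inner products of the first part genuine integrals.
    The second part expresses T^* = -T on the domain of T through the graph of T^*, up to null sets
    because elements of L_2 are classes of functions. *)
Theorem mainTheorem3 (R : realType) :
  (forall f g : R[i] -> R[i],
     analytic_on strip f -> analytic_on strip g ->
     slice_decay f -> slice_decay g ->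
     real_on_line f -> real_on_line g ->
     cintegrable (fun x => on_line (central_diff f) x * on_line g x) ->
     cintegrable (fun x => on_line f x * on_line (central_diff g) x) ->
     inner (on_line (central_diff f)) (on_line g) = - inner (on_line f) (on_line (central_diff g)))
  /\
  (forall g : R[i] -> R[i], dom_T g ->
     forall H : R -> R[i],
       adjoint_T (on_line g) H <->
       real_L2 H /\
       \forall x \ae (@lebesgue_measure R), H x = - on_line (central_diff g) x).
Proof.
split=> [f g af ag sf sg _ _|g dg H]; first exact: central_diff_skew.
have [[ag sg _] [w w2 gw] [t t2 Tgt]] := dg.
have skew f : dom_T f -> inner (on_line (central_diff f)) (on_line g) =
    - inner (on_line f) (on_line (central_diff g)).
  move=> [[af sf _] [u u2 fu] [s s2 Tfs]].
  by apply: central_diff_skew => //;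
    [exact: (Lfun2_real_cintegrable s2 w2)|exact: (Lfun2_real_cintegrable u2 t2)].
split=> [[_ H2 adj]|[H2 [N [mN N0 subN]]]].
- split=> //; have [h h2 Hh] := H2.
  (* This is H + Tg, orthogonal to the domain of T because (f, H) = (Tf, g) = -(f, Tg). *)
  pose v x := h x + t x.
  have v2 : v \in Lfun (@lebesgue_measure R) 2%:E.
    have p1 : (1 <= 2%:E :> \bar R)%E by rewrite lee_fin ler1n.
    exact: ((Lfun_addr_closed _ p1).2 _ _ h2 t2).
  have := dom_T_orthogonal_ae0 v2.
  have orth (f : R[i] -> R[i]) : dom_T f ->
      \int[@lebesgue_measure R]_x (complex.Re (f x%:C) * v x) = 0.
    move=> df; have [_ [u u2 fu] _] := df.
    have iut := Lfun2_mul_integrable u2 t2; have iuh := Lfun2_mul_integrable u2 h2.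
    have := adj f df; rewrite skew// (inner_real fu Tgt) (inner_real fu Hh) -rmorphN.
    move=> /complexI E.
    have -> : \int[@lebesgue_measure R]_x (complex.Re (f x%:C) * v x) =
        \int[@lebesgue_measure R]_x (u x * h x + u x * t x).
      by apply: eq_Rintegral => x _; rewrite -mulrDr -[f _]/(on_line f x) fu.
    by rewrite RintegralD// -E addNr.
  move=> /(_ orth) [N [mN N0 subN]]; exists N; split=> // x /= nx.
  apply: subN => /= vx; apply: nx; rewrite Hh Tgt -rmorphN; congr (_%:C).
  by apply/eqP; rewrite -addr_eq0; apply/eqP.
split=> //.
  by exists w.
(* Skew symmetry turns the left side into -(f, Tg), which equals (f, H) since the integrands agree
   almost everywhere. *)
move=> f df; rewrite skew//; have [_ [u u2 fu] _] := df; have [h h2 Hh] := H2.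
rewrite (inner_real fu Tgt) (inner_real fu Hh) -rmorphN; congr (_%:C).
have iut := Lfun2_mul_integrable u2 t2; have iuh := Lfun2_mul_integrable u2 h2.
rewrite -mulN1r -RintegralZl//; congr fine.
apply: ae_eq_integral => //.
+ exact: (measurable_int _ (integrableZl _ (-1) iut)).
+ exact: (measurable_int _ iuh).
exists N; split=> // x /= nx; apply: subN => /= Hx; apply: nx => _.
congr EFin; rewrite mulN1r -mulrN; congr (_ * _).
by apply: complexI; rewrite -Hh Hx Tgt rmorphN.
Qed.
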